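(* For all integers $m\ge 0$ and $n\ge 1$ we have $\omega(d_m)=\omega(a_{m,n})$.
   Context: For positive integers $a,b$ put $Z(a,b):=\dfrac{ab}{(\gcd(a,b))^2}$, which is a positive integer. Let $p_1=2,p_2=3,p_3=5,\dots$ be the increasing sequence of all prime numbers. Define the array of positive integers $a_{m,n}$ ($m\ge 0$, $n\ge 1$) by $a_{0,n}:=p_n$ for $n\ge 1$ and $a_{m+1,n}:=Z(a_{m,n},a_{m,n+1})$ for $m\ge 0$, $n\ge 1$. Let $d_m:=a_{m,1}$ be the first element of row $m$. For a positive integer $a$, $\omega(a)$ denotes the number of distinct prime factors of $a$ (all the $a_{m,n}$ are square free). *)

(* Defs.v *)
From mathcomp Require Import all_boot.

Set Implicit Arguments.
Unset Strict Implicit.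
Unset Printing Implicit Defensive.

(* The division is exact: see [Zop_mul]. *)
Definition Zop (a b : nat) : nat := (a * b) %/ gcdn a b ^ 2.

Lemma Zop_mul (a b : nat) : Zop a b * gcdn a b ^ 2 = a * b.
Proof. by rewrite divnK // expnS expn1 dvdn_mul ?dvdn_gcdl ?dvdn_gcdr. Qed.

Lemma ex_prime_above (k : nat) : exists p, (k < p) && prime p.
Proof. by have [p kp pp] := prime_above k; exists p; rewrite kp pp. Qed.

Definition next_prime (k : nat) : nat := ex_minn (ex_prime_above k).

(* Indexed from 1, as in p_1 = 2; the value 0 at index 0 is a dummy. *)
Definition nth_prime (n : nat) : nat := iter n next_prime 0.

Lemma nth_prime1 : nth_prime 1 = 2.
Proof.
rewrite /nth_prime /= /next_prime; case: ex_minnP => p /andP[_ pp] /(_ 2 isT) p2.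
by apply/eqP; rewrite eqn_leq p2 prime_gt1.
Qed.

Lemma prime_nth_prime (n : nat) : 0 < n -> prime (nth_prime n).
Proof.
by case: n => // n _; rewrite /nth_prime /= /next_prime; case: ex_minnP => p /andP[].
Qed.

Lemma nth_prime_ltS (n : nat) : nth_prime n < nth_prime n.+1.
Proof.
by rewrite /nth_prime /= {2}/next_prime; case: ex_minnP => p /andP[].
Qed.

Lemma nth_prime_surj (p : nat) : prime p -> exists2 n, 0 < n & nth_prime n = p.
Proof.
move=> pp; have ge_id n : n <= nth_prime n.
  by elim: n => // n IHn; apply: leq_ltn_trans IHn (nth_prime_ltS n).
have /ex_minnP[[|n] le_p min_n] : exists n, p <= nth_prime n by exists p.
  by move: le_p; rewrite leqNgt prime_gt0.
exists n.+1 => //; apply/eqP; rewrite eqn_leq le_p andbT.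
have lt_p : nth_prime n < p.
  by rewrite ltnNge; apply/negP => /min_n; rewrite ltnn.
rewrite /nth_prime /= /next_prime; case: ex_minnP => q _; apply.
by rewrite lt_p pp.
Qed.

(* [prime_array m n] is meaningful for [m >= 0] and [n >= 1]; the entries with
   [n >= 1] never depend on the dummy column [n = 0]. *)
Fixpoint prime_array (m n : nat) : nat :=
  if m is m'.+1 then Zop (prime_array m' n) (prime_array m' n.+1)
  else nth_prime n.

Definition row_head (m : nat) : nat := prime_array m 1.

Definition omega (a : nat) : nat := size (primes a).

(* Main.v *)
Require Import Defs.
From mathcomp Require Import all_boot.

(** The array commutes with moving every prime to its successor.  On exponents,
    [Zop] is the absolute difference ([logn_Zop]), a rule applied to each prime
    separately and in the same way for all of them; and row [0] moved one column
    to the right is row [0] with each prime replaced by the next one.  Hence the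
    exponent of the next prime after [q] in [prime_array m n.+1] equals the
    exponent of [q] in [prime_array m n] ([logn_prime_array_shift]).

    The successor map on primes is injective, and it misses only the prime 2,
    which divides no entry beyond the first column.  So it maps the prime
    divisors of [prime_array m n] bijectively onto those of
    [prime_array m n.+1] ([primes_prime_array_shift]): along a row the number of
    prime divisors never changes. *)

Lemma Zop_gt0 a b : 0 < a -> 0 < b -> 0 < Zop a b.
Proof.
move=> a_gt0 b_gt0; have : 0 < Zop a b * gcdn a b ^ 2.
  by rewrite Zop_mul muln_gt0 a_gt0.
by rewrite muln_gt0 => /andP[].
Qed.

(** Dividing by the squared gcd takes twice the smaller exponent away from the
    sum of the two, which leaves their absolute difference; the latter is written
    as a sum of truncated differences, one of which is [0]. *)
Lemma logn_Zop p a b : 0 < a -> 0 < b ->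
  logn p (Zop a b) = (logn p a - logn p b) + (logn p b - logn p a).
Proof.
move=> a_gt0 b_gt0; have := congr1 (logn p) (Zop_mul a b).
have g_gt0 : 0 < gcdn a b ^ 2 by rewrite expn_gt0 gcdn_gt0 a_gt0.
have Z_gt0 := Zop_gt0 _ _ a_gt0 b_gt0.
rewrite lognM // lognM // lognX logn_gcd // mul2n -addnn.
case: (leqP (logn p a) (logn p b)) => [le_ab | /ltnW le_ba] eqZ.
  rewrite (eqP le_ab) add0n; apply/eqP.
  by rewrite -(eqn_add2r (logn p a + logn p a)) eqZ addnA subnK // addnC.
rewrite (eqP le_ba) addn0; apply/eqP.
by rewrite -(eqn_add2r (logn p b + logn p b)) eqZ addnA subnK.
Qed.

Lemma nth_prime_inj : injective nth_prime.
Proof.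
exact: incn_inj (leq_mono (homo_ltn ltn_trans nth_prime_ltS)).
Qed.

Lemma prime_array_gt0 m n : 0 < n -> 0 < prime_array m n.
Proof.
elim: m n => [|m IHm] n n_gt0 /=; first exact/prime_gt0/prime_nth_prime.
by rewrite Zop_gt0 ?IHm.
Qed.

Lemma logn_prime_arrayS p m n : 0 < n ->
  let x := logn p (prime_array m n) in
  let y := logn p (prime_array m n.+1) in
  logn p (prime_array m.+1 n) = (x - y) + (y - x).
Proof. by move=> n_gt0; apply: logn_Zop; apply: prime_array_gt0. Qed.

Lemma logn_nth_prime k n : 0 < n ->
  logn (nth_prime k) (nth_prime n) = (k == n).
Proof.
by move=> n_gt0; rewrite logn_prime ?prime_nth_prime // (inj_eq nth_prime_inj).
Qed.

(** At [k = 0] the right-hand side is the exponent of the dummy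
    [nth_prime 0 = 0], and [logn 0] is identically [0]: that case says that 2
    divides no entry beyond the first column. *)
Lemma logn_prime_array_shift m n k : 0 < n ->
  logn (nth_prime k.+1) (prime_array m n.+1)
    = logn (nth_prime k) (prime_array m n).
Proof.
elim: m n => [|m IHm] n n_gt0; first by rewrite !logn_nth_prime.
by rewrite !logn_prime_arrayS // !IHm.
Qed.

(** The shift of exponents, read on supports.  The two lists are compared only up
    to order, which suffices for counting and needs no monotonicity of
    [next_prime]. *)
Lemma primes_prime_array_shift m n : 0 < n ->
  perm_eq (primes (prime_array m n.+1))
          [seq next_prime q | q <- primes (prime_array m n)].
Proof.
move=> n_gt0; apply: uniq_perm; first exact: primes_uniq.
  rewrite map_inj_in_uniq ?primes_uniq // => q r.
  rewrite !mem_primes => /and3P[/nth_prime_surj[i _ <-] _ _].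
  case/and3P=> /nth_prime_surj[j _ <-] _ _.
  by move/(@nth_prime_inj i.+1 j.+1) => [->].
move=> q; apply/idP/mapP => [q_div | [r r_div ->]].
  have /nth_prime_surj[[//|k] _ def_q] : prime q.
    by move: q_div; rewrite mem_primes => /andP[].
  (* When [q] is 2 this witness is the dummy 0, and the shift lemma makes the
     claim that 0 is a prime divisor equivalent to the hypothesis on 2. *)
  exists (nth_prime k); last by rewrite -def_q.
  by move: q_div; rewrite -def_q -!logn_gt0 logn_prime_array_shift.
have /nth_prime_surj[k _ def_r] : prime r.
  by move: r_div; rewrite mem_primes => /andP[].
move: r_div; rewrite -def_r -[next_prime _]/(nth_prime k.+1) -!logn_gt0.
by rewrite logn_prime_array_shift.
Qed.

Theorem theorem2 (m n : nat) (hn : 1 <= n) :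
  omega (row_head m) = omega (prime_array m n).
Proof.
case: n hn => // n _; elim: n => [//|n ->].
by rewrite /omega (perm_size (primes_prime_array_shift m n.+1 isT)) [RHS]size_map.
Qed.
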